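(* Let $q$ be a prime power and let $C$ be the set of points contained in a hyperbolic line of $\mathsf{W}_3(q)$. Then $C$ is a neighbour-transitive maximal partial ovoid.
   Context: $\mathsf{W}_3(q)$: let $V=\mathbb{F}_q^4$ be equipped with a non-degenerate symplectic bilinear form $f$. Points are the $1$-dimensional subspaces of $V$, lines are the totally isotropic $2$-dimensional subspaces of $V$, incidence is symmetrised containment. Its point-line incidence graph $\varGamma$ has all points and lines as vertices, with adjacency given by incidence. A hyperbolic line is a $2$-dimensional subspace $W$ of $V$ on which $f$ is non-degenerate; its points are the $q+1$ one-dimensional subspaces of $W$. A partial ovoid is a set of points such that each line is incident with at most one point of the set; it is maximal if it is not properly contained in another partial ovoid. A code $C$ is a subset of the vertex set of $\varGamma$; $C_1$ is the set of vertices not in $C$ that are adjacent to some element of $C$; $\operatorname{Aut}(C)$ is the setwise stabiliser of $C$ in $\operatorname{Aut}(\varGamma)$; $C$ is neighbour-transitive if $\operatorname{Aut}(C)$ acts transitively on each of $C$ and $C_1$. *)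

(* Defs.v *)
From HB Require Import structures.
From mathcomp Require Import all_boot all_order all_fingroup all_algebra.

Set Implicit Arguments.
Unset Strict Implicit.
Unset Printing Implicit Defensive.

Import GRing.Theory.

Local Open Scope ring_scope.

(* vector.v stops at choiceType for {vspace vT}; over a finite field it is    *)
(* finite, as a subtype of square matrices.                                   *)
Section FiniteVspace.
Import VectorInternalTheory.
Variables (F : finFieldType) (vT : vectType F).

HB.instance Definition _ := [Countable of {vspace vT} by <:].
HB.instance Definition _ := [Finite of {vspace vT} by <:].

End FiniteVspace.

Section Graph.
Variables (T : finType) (e : rel T).

Definition graph_aut : {set {perm T}} :=
  [set s : {perm T} | [forall x, forall y, e (s x) (s y) == e x y]].

Lemma graph_aut_group_set : group_set graph_aut.
Proof.
apply/group_setP; split=> [|s t].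
  by rewrite inE; apply/'forall_forallP => x y; rewrite !perm1.
rewrite !inE => /'forall_'forall_eqP es /'forall_'forall_eqP et.
by apply/'forall_'forall_eqP => x y; rewrite !permM et es.
Qed.
Canonical graph_aut_group := Group graph_aut_group_set.

Definition neighbours (C : {set T}) : {set T} :=
  [set v | (v \notin C) && [exists c in C, e c v]].

Definition code_aut (C : {set T}) : {set {perm T}} := 'N_graph_aut(C | 'P)%g.

(* atrans is false on the empty set, so nonemptiness of C and of its          *)
(* neighbour set is part of this predicate.                                   *)
Definition neighbour_transitive (C : {set T}) : bool :=
  [transitive code_aut C, on C | 'P]
  && [transitive code_aut C, on neighbours C | 'P].

End Graph.

Section SymplecticQuadrangle.
(* Alternation of f in characteristic 2 is not part of the type; it comes     *)
(* with is_psymplectic, as does nondegeneracy.                                *)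
Variables (F : finFieldType) (f : {skew_symmetric 'rV[F]_4}).

Definition point := {U : {vspace 'rV[F]_4} | \dim U == 1%N}.

Definition line :=
  {U : {vspace 'rV[F]_4} | (\dim U == 2%N) && (U <= orthov f U)%VS}.

Definition vertex : Type := (point + line)%type.
HB.instance Definition _ := Finite.on vertex.

Definition adjacent : rel vertex := fun x y =>
  match x, y with
  | inl p, inr l | inr l, inl p => (val p <= val l)%VS
  | _, _ => false
  end.

Definition is_hyperbolic_line (W : {vspace 'rV[F]_4}) : Prop :=
  \dim W = 2%N /\ {in W, forall u, {in W, forall v, f u v = 0} -> u = 0}.

Definition points_in (W : {vspace 'rV[F]_4}) : {set vertex} :=
  [set inl p | p : point & (val p <= W)%VS].

Definition partial_ovoid (C : {set vertex}) : bool :=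
  (C \subset [set inl p | p : point])
  && [forall l : line, #|[set c in C | adjacent c (inr l)]| <= 1]%N.

Definition maximal_partial_ovoid (C : {set vertex}) : bool :=
  maxset partial_ovoid C.

End SymplecticQuadrangle.

Arguments adjacent {F} f.
Arguments partial_ovoid {F} f.
Arguments maximal_partial_ovoid {F} f.

(* Main.v *)
(* Write the space as the orthogonal sum of the hyperbolic line W and its       *)
(* perp W', both nondegenerate planes. Isotropic lines meeting W are exactly    *)
(* the <u> + <w> with u in W and w in W': hence the neighbours of C correspond  *)
(* to pairs of points of W and W'. The transvections along vectors of W are     *)
(* transitive on the points of W and fix W' pointwise, and symmetrically for    *)
(* W', so products of the two are transitive on such pairs. An isotropic line   *)
(* with two points in W would be W itself, while any point <v> off W is         *)
(* collinear with <u>, for u nonzero in W and orthogonal to v.                  *)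

From HB Require Import structures.
Require Import Defs.
From mathcomp Require Import all_boot all_order all_fingroup all_algebra.

Set Implicit Arguments.
Unset Strict Implicit.
Unset Printing Implicit Defensive.

Import GRing.Theory.

Local Open Scope ring_scope.

(** The pivot is [plane_orthogonal]: in a nondegenerate plane, orthogonal nonzero vectors span the
    same point. It gives the partial ovoid property and, through [neighbour_points_in], the
    description of the neighbours. Transitivity comes from [plane_transitive], applied to the plane
    and to its orthogonal and combined in [plane_isometry]; [img_vertex_code_aut] carries the
    isometries over to the incidence graph. Maximality is a dimension count. *)

(** * Nondegenerate planes and transvections in a symplectic space *)

Section SymplecticSpace.
Variables (F : fieldType) (vT : vectType F) (f : {skew_symmetric vT}).
Hypothesis f_alt : forall u, f u u = 0.
Implicit Types (u v w x y a : vT) (U V : {vspace vT}) (g : 'End(vT)).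

Lemma skewC u v : f u v = - f v u.
Proof. by rewrite hermC expr1 mulN1r. Qed.

(** Same body as [is_hyperbolic_line], over any ambient space; it is applied to the hyperbolic line
    and to its orthogonal. *)
Definition hyperbolic_plane U : Prop :=
  \dim U = 2%N /\ {in U, forall u, {in U, forall v, f u v = 0} -> u = 0}.

Definition transvection k a x : vT := x + (k * f x a) *: a.

Lemma transvection_is_linear k a : linear (transvection k a).
Proof.
move=> c x y; rewrite /transvection linearPl scalerDr scalerA addrACA -scalerDl.
by congr (_ + _ *: _); rewrite mulrDr mulrCA.
Qed.
HB.instance Definition _ k a :=
  GRing.isLinear.Build F vT vT _ (transvection k a) (transvection_is_linear k a).

(** The two cross terms cancel by skew symmetry, and the quadratic term contains [f a a]. *)
Lemma transvection_isometry k a : isometry f f (linfun (transvection k a)).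
Proof.
move=> x y; rewrite !lfunE /transvection /=.
rewrite !(linearDl, linearDr, linearZl_LR, linearZr) /= f_alt (skewC a y).
by rewrite !mulr0 addr0 mulrN mulrAC addrK.
Qed.

Lemma isometry_lker0 g : nondegenerate f -> isometry f f g -> lker g == 0%VS.
Proof.
move=> /eqP rad0 g_iso; rewrite -subv0 -rad0; apply/subvP => x.
rewrite memv_ker => /eqP gx0; apply/mem_orthovP => y _.
by rewrite -g_iso gx0 linear0l.
Qed.

Lemma eq_vline u v : u != 0 -> v \in <[u]>%VS -> v != 0 -> (<[v]> = <[u]>)%VS.
Proof.
by move=> u0 vu v0; apply/eqP; rewrite eqEdim -memvE vu !dim_vline u0 v0.
Qed.

Section Plane.
Variable U : {vspace vT}.
Hypothesis planeU : hyperbolic_plane U.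

Lemma plane_span u v : u \in U -> v \in U -> u != 0 -> v \notin <[u]>%VS ->
  U = (<[u]> + <[v]>)%VS.
Proof.
move=> uU vU u0 vu; apply/esym/eqP; rewrite eqEdim subv_add -!memvE uU vU /=.
case: planeU => -> _; rewrite ltnNge; apply: contra vu => dimD.
have /eqP uD : <[u]>%VS == (<[u]> + <[v]>)%VS.
  by rewrite eqEdim addvSl dim_vline u0.
by rewrite memvE uD addvSr.
Qed.

(** Otherwise [u] and [v] span [U], and [u], orthogonal to both, lies in the radical of [U]. *)
Lemma plane_orthogonal u v : u \in U -> v \in U -> u != 0 -> f u v = 0 ->
  v \in <[u]>%VS.
Proof.
move=> uU vU u0 fuv; have := u0; apply: contraNT => vu; apply/eqP.
apply: (planeU.2 _ uU) => w; rewrite (plane_span uU vU u0 vu).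
case/memv_addP=> _ /vlineP[c ->] [_ /vlineP[d ->] ->].
by rewrite linearDr !linearZr /= f_alt fuv !mulr0 addr0.
Qed.

Lemma plane_cap_orthov : (U :&: orthov f U = 0)%VS.
Proof.
apply/eqP; rewrite -subv0; apply/subvP => x /memv_capP[xU /mem_orthovP fx].
by rewrite memv0 (planeU.2 x xU fx).
Qed.

Lemma plane_proj x : exists2 w, w \in U & x - w \in orthov f U.
Proof.
have U0 : U != 0%VS by rewrite -dimv_eq0 planeU.1.
have aU := memv_pick U; set a := vpick U in aU.
have a0 : a != 0 by rewrite vpick0.
have: a \notin orthov f U.
  by apply: contra a0 => /mem_orthovP /(planeU.2 a aU) ->.
case/mem_orthovPn => b bU fab.
have ba : b \notin <[a]>%VS.
  by apply: contra fab => /vlineP[c ->]; rewrite linearZr /= f_alt mulr0.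
(* The coefficients are those that make this vector pair with [a] and with [b] as [x] does. *)
exists ((f x b / f a b) *: a - (f x a / f a b) *: b).
  by rewrite memvB ?memvZ.
apply/mem_orthovP => v; rewrite (plane_span aU bU a0 ba).
case/memv_addP=> _ /vlineP[c ->] [_ /vlineP[d ->] ->].
rewrite linearDr !linearZr /= !(linearBl, linearZl_LR) /= !f_alt (skewC b a).
by rewrite !mulr0 subr0 sub0r mulrN opprK !divfK // !subrr !mulr0 addr0.
Qed.

Lemma plane_add_orthov : (U + orthov f U = fullv)%VS.
Proof.
apply/vspaceP => x; rewrite memvf; have [w wU xw] := plane_proj x.
by apply/memv_addP; exists w => //; exists (x - w); rewrite // addrC subrK.
Qed.

(** The dimension is 4 - 2 because the sum is direct and full; a radical vector of the orthogonal is
    orthogonal to both summands, hence zero. *)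
Lemma orthov_plane : nondegenerate f -> dim vT = 4%N ->
  hyperbolic_plane (orthov f U).
Proof.
move=> /eqP rad0 dim4; split.
  apply/eqP; rewrite -(eqn_add2l 2) -{1}planeU.1 -dimv_disjoint_sum.
    by rewrite plane_add_orthov dimvf dim4.
  exact: plane_cap_orthov.
move=> u uU fu; apply/eqP; rewrite -memv0 -rad0 -plane_add_orthov.
apply/mem_orthovP => _ /memv_addP[w wU [w' w'U ->]].
by rewrite linearDr /= (mem_orthovP uU) // fu // addr0.
Qed.

(* The transvection along [u - v] scaled by [1 / f u v] maps [u] to [v]. *)
Lemma plane_transitive u v : nondegenerate f ->
    u \in U -> v \in U -> u != 0 -> v != 0 ->
  exists g, [/\ isometry f f g, (g @: U = U)%VS,
    {in orthov f U, g =1 id} & (g @: <[u]> = <[v]>)%VS].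
Proof.
move=> ndg uU vU u0 v0; have [fuv|fuv] := eqVneq (f u v) 0.
  exists \1%VF; split; rewrite ?lim1g //.
  - by move=> x y; rewrite !id_lfunE.
  - by move=> x _; rewrite id_lfunE.
  - by apply/esym/eq_vline => //; apply: plane_orthogonal.
have uvU : u - v \in U by apply: memvB.
pose g := linfun (transvection (f u v)^-1 (u - v)); exists g.
have g_iso : isometry f f g by apply: transvection_isometry.
have g_inj := isometry_lker0 ndg g_iso.
split=> //.
- apply/eqP; rewrite eqEdim limg_dim_eq; last by rewrite (eqP g_inj) capv0.
  rewrite leqnn andbT; apply/subvP => _ /memv_imgP[x xU ->].
  by rewrite lfunE memvD ?memvZ.
- move=> x /mem_orthovP/(_ _ uvU) fx.
  by rewrite lfunE /= /transvection fx mulr0 scale0r addr0.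
rewrite limg_line lfunE /= /transvection linearBr /= f_alt sub0r mulrN mulVf //.
by rewrite scaleN1r opprB addrC subrK.
Qed.

End Plane.

End SymplecticSpace.

(** * Automorphisms of a code in a graph *)

Section Graph.
Variables (T : finType) (e : rel T).
Implicit Types C S : {set T}.

Lemma mem_code_autP C (s : {perm T}) :
  reflect ((forall x y, e (s x) (s y) = e x y) /\
           (forall x, (s x \in C) = (x \in C))) (s \in code_aut e C).
Proof.
rewrite /code_aut inE; apply: (iffP andP).
  rewrite inE => -[/'forall_'forall_eqP es /astabsP sC].
  by split=> [|x]; [exact: es | exact: sC].
move=> [es sC]; rewrite inE; split; first exact/'forall_'forall_eqP.
by apply/astabsP => x; exact: sC.
Qed.

(** Transitivity means that [S] is exactly one orbit, so stability of [S] is asked for besides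
    moving any element to any other. *)
Lemma code_aut_transitive C S : S != set0 ->
    (forall s : {perm T}, s \in code_aut e C -> forall x, x \in S -> s x \in S) ->
    {in S &, forall x y, exists2 s : {perm T}, s \in code_aut e C & s x = y} ->
  [transitive code_aut e C, on S | 'P].
Proof.
case/set0Pn=> x xS stabS transS; apply/imsetP; exists x => //.
apply/setP => y; apply/idP/imsetP => [yS|[s sC ->]]; last exact: stabS.
by have [s sC <-] := transS x y xS yS; exists s.
Qed.

Lemma code_aut_neighbours C (s : {perm T}) x :
  s \in code_aut e C -> x \in neighbours e C -> s x \in neighbours e C.
Proof.
case/mem_code_autP=> es sC; rewrite !inE sC => /andP[-> /exists_inP[c cC ecx]].
by apply/exists_inP; exists (s c); rewrite ?sC ?es.
Qed.

End Graph.

(** * The generalised quadrangle and the action of isometries on its vertices *)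

Section Quadrangle.
Variables (F : finFieldType) (f : {skew_symmetric 'rV[F]_4}).
Hypotheses (f_alt : forall u, f u u = 0) (f_ndg : nondegenerate f).
Implicit Types (u v : 'rV[F]_4) (U W : {vspace 'rV[F]_4}).
Implicit Types (g : 'End('rV[F]_4)) (p : point F) (l : line f) (x y : vertex f).

Lemma pointP p : exists2 u, u != 0 & val p = <[u]>%VS.
Proof.
exists (vpick (val p)); first by rewrite vpick0 -dimv_eq0 (eqP (valP p)).
by apply/esym/eqP; rewrite eqEdim -memvE memv_pick (eqP (valP p)) dim_vline
  vpick0 -dimv_eq0 (eqP (valP p)).
Qed.

Lemma exists_point u : u != 0 -> exists p, val p = <[u]>%VS.
Proof.
move=> u0; have pu : \dim <[u]> == 1%N by rewrite dim_vline u0.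
by exists (Sub <[u]>%VS pu : point F); rewrite SubK.
Qed.

Lemma exists_line u v : u != 0 -> v \notin <[u]>%VS -> f u v = 0 ->
  exists l, val l = (<[u]> + <[v]>)%VS.
Proof.
move=> u0 vu fuv.
have lP : (\dim (<[u]> + <[v]>)%VS == 2%N) &&
    (<[u]> + <[v]> <= orthov f (<[u]> + <[v]>))%VS.
  rewrite orthoDv !orthovD !orthov11 !f_alt (skewC f v u) fuv oppr0 !eqxx !andbT.
  have v0 : v != 0 by apply: contraNneq vu => ->; rewrite mem0v.
  rewrite dimv_disjoint_sum ?dim_vline ?u0 ?v0 //.
  apply/eqP; rewrite -subv0; apply/subvP => _ /memv_capP[/vlineP[c ->]].
  case/vlineP=> d cu_dv; rewrite cu_dv memv0 scaler_eq0.
  have [//|d0] := eqVneq d 0; case/negP: vu; apply/vlineP; exists (d^-1 * c).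
  by rewrite -scalerA cu_dv scalerA mulVf // scale1r.
by exists (Sub (<[u]> + <[v]>)%VS lP : line f); rewrite SubK.
Qed.

Lemma line_isotropic l u v : u \in val l -> v \in val l -> f u v = 0.
Proof. by case/andP: (valP l) => _ /orthovP; apply. Qed.

Lemma mem_points_in W p : (inl p \in points_in f W) = (val p <= W)%VS.
Proof.
by apply/imsetP/idP => [[p' + [->]]|pW]; [rewrite inE | exists p; rewrite ?inE].
Qed.

Lemma inr_points_in W l : (inr l \in points_in f W) = false.
Proof. by apply/negP => /imsetP[]. Qed.

(** For an arbitrary [g] the image may fail to be a point or an isotropic line, and [insubd] then
    returns the old vertex; for an isometry this default is never reached. *)
Definition img_vertex g (x : vertex f) : vertex f :=
  match x with
  | inl p => inl (insubd p (g @: val p)%VS)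
  | inr l => inr (insubd l (g @: val l)%VS)
  end.

Section Isometry.
Variable g : 'End('rV[F]_4).
Hypothesis g_iso : isometry f f g.

Let g_inj : lker g == 0%VS := isometry_lker0 f_ndg g_iso.

Lemma isometry_dim U : \dim (g @: U) = \dim U.
Proof. by rewrite limg_dim_eq // (eqP g_inj) capv0. Qed.

Lemma val_img_point p : val (insubd p (g @: val p)%VS) = (g @: val p)%VS.
Proof. by rewrite val_insubd isometry_dim (valP p). Qed.

Lemma val_img_line l : val (insubd l (g @: val l)%VS) = (g @: val l)%VS.
Proof.
rewrite val_insubd isometry_dim; case/andP: (valP l) => -> /orthovP l_iso.
rewrite ifT //; apply/orthovP => _ _ /memv_imgP[u ul ->] /memv_imgP[v vl ->].
by rewrite g_iso l_iso.
Qed.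

Lemma img_vertex_inj : injective (img_vertex g).
Proof.
move=> [p|l] [p'|l'] //= [/(congr1 val)].
  rewrite !val_img_point => /eqP; rewrite eq_limg_ker0 // => /eqP/val_inj -> //.
by rewrite !val_img_line => /eqP; rewrite eq_limg_ker0 // => /eqP/val_inj ->.
Qed.

Lemma adjacent_img x y :
  adjacent f (img_vertex g x) (img_vertex g y) = adjacent f x y.
Proof.
by case: x y => [p|l] [p'|l'] //=; rewrite val_img_point val_img_line limg_ker0.
Qed.

Lemma img_vertex_code_aut W : (g @: W = W)%VS ->
  perm img_vertex_inj \in code_aut (adjacent f) (points_in f W).
Proof.
move=> gW; apply/mem_code_autP; split=> [x y|[p|l]]; rewrite !permE.
- exact: adjacent_img.
- by rewrite !mem_points_in val_img_point -{1}gW limg_ker0.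
- by rewrite !inr_points_in.
Qed.

End Isometry.

(** * The code of points of a hyperbolic line *)

Section HyperbolicLine.
Variable W : {vspace 'rV[F]_4}.
Hypothesis planeW : hyperbolic_plane f W.

Let W' := orthov f W.
Let planeW' : hyperbolic_plane f W' :=
  orthov_plane f_alt planeW f_ndg (dim_matrix _ _ _).

Lemma notin_vline_orthov u w :
  u \in W -> u != 0 -> w \in W' -> w != 0 -> w \notin <[u]>%VS.
Proof.
move=> uW u0 wW' w0; apply: contra w0 => /vlineP[c w_cu].
rewrite -memv0 -(plane_cap_orthov planeW).
by apply/memv_capP; split=> //; rewrite w_cu memvZ.
Qed.

(** Take [y] on the line outside the point [<[u]>] of [W], and its projection [a] to [W]. Both [y]
    and [y - a] are orthogonal to [u], hence so is [a], which is therefore a multiple of [u]; thus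
    [y - a] is a nonzero vector of the line in [W']. *)
Lemma neighbour_points_in x : x \in neighbours (adjacent f) (points_in f W) ->
  exists u, exists w, exists l,
    [/\ [/\ u \in W, u != 0, w \in W' & w != 0],
        x = inr l & val l = (<[u]> + <[w]>)%VS].
Proof.
rewrite inE => /andP[_ /exists_inP[_ /imsetP[p + ->]]]; rewrite inE.
case: x => // l; have [u u0 /= ->] := pointP p; rewrite -!memvE => uW ul.
have: ~~ (val l <= <[u]>)%VS.
  apply: contraL (valP l) => /dimvS; rewrite dim_vline u0.
  by case: (\dim _) => [|[]].
case/subvPn => y yl yu; have [a aW yaW'] := plane_proj f_alt planeW y.
have fua : f u a = 0.
  rewrite -(subrK y a) linearDr /= (line_isotropic ul yl) addr0 -opprB linearNr /=.
  by rewrite skewC (mem_orthovP yaW') // !oppr0.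
have au := plane_orthogonal f_alt planeW uW aW u0 fua.
have al : a \in val l by apply: subvP au; rewrite -memvE.
have ya0 : y - a != 0 by apply: contra yu; rewrite subr_eq0 => /eqP ->.
exists u, (y - a), l; split=> //; apply/esym/eqP.
rewrite eqEdim subv_add -!memvE ul memvB //=.
case/andP: (valP l) => /eqP -> _; rewrite dimv_disjoint_sum ?dim_vline ?u0 ?ya0 //.
apply/eqP; rewrite -subv0 -(plane_cap_orthov planeW) subv_cap.
by rewrite (subv_trans (capvSl _ _)) -?memvE // (subv_trans (capvSr _ _)) -?memvE.
Qed.

Lemma plane_isometry u1 u2 w1 w2 :
    u1 \in W -> u2 \in W -> u1 != 0 -> u2 != 0 ->
    w1 \in W' -> w2 \in W' -> w1 != 0 -> w2 != 0 ->
  exists g : 'End('rV[F]_4), [/\ isometry f f g, (g @: W = W)%VS,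
    (g @: <[u1]> = <[u2]>)%VS & (g @: <[w1]> = <[w2]>)%VS].
Proof.
move=> u1W u2W u10 u20 w1W w2W w10 w20.
have [g [g_iso gW g1 gu]] := plane_transitive f_alt planeW f_ndg u1W u2W u10 u20.
have [h [h_iso _ h1 hw]] :=
  plane_transitive f_alt planeW' f_ndg w1W w2W w10 w20.
(* [h] fixes the orthogonal of [W'] pointwise, and that contains [W]. *)
have {}h1 : {in W, h =1 \1%VF}.
  move=> x xW; rewrite id_lfunE; apply: h1; apply/mem_orthovP => y yW'.
  by rewrite skewC (mem_orthovP yW') // oppr0.
exists (h \o g)%VF; split.
- by move=> x y; rewrite !comp_lfunE h_iso g_iso.
- by rewrite limg_comp gW (eq_in_limg h1) lim1g.
- by rewrite limg_comp gu limg_line h1 // id_lfunE.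
- by rewrite limg_comp (limg_line g) g1.
Qed.

Lemma points_in_partial_ovoid : partial_ovoid f (points_in f W).
Proof.
apply/andP; split.
  by apply/subsetP => _ /imsetP[p _ ->]; rewrite mem_imset // => ? ? [].
apply/forallP => l; apply/card_le1_eqP => x y; rewrite !inE.
case/andP => /imsetP[p + ->] pl /andP[/imsetP[q + ->] ql]; rewrite !inE.
move: pl ql; have [u u0 pu] := pointP p; have [v v0 qv] := pointP q.
rewrite /= pu qv -!memvE => ul vl uW vW; congr inl; apply: val_inj.
rewrite pu qv; apply: eq_vline => //.
exact: (plane_orthogonal f_alt planeW uW vW u0 (line_isotropic ul vl)).
Qed.

Lemma points_in_maximal : maximal_partial_ovoid f (points_in f W).
Proof.
apply/maxsetP; split=> [|D /andP[/subsetP D_pt /forallP D_ovoid] WD].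
  exact: points_in_partial_ovoid.
apply/eqP; rewrite eqEsubset WD andbT; apply/subsetP => x xD.
have /imsetP[p _ x_p] := D_pt x xD; rewrite {x}x_p in xD *.
rewrite mem_points_in; apply: contraT; have [v v0 pv] := pointP p.
rewrite pv -memvE => vW.
(* Orthogonality to [v] is one linear condition on the plane [W], so a nonzero [u] in [W] satisfies
   it; the line through [u] and [v] then meets [D] twice. *)
have /lt0n_neq0 : (0 < \dim (W :&: orthov f <[v]>))%N.
  by apply: leq_trans (leq_dim_orthov1 f v W); rewrite planeW.1.
rewrite dimv_eq0 -vpick0; have := memv_pick (W :&: orthov f <[v]>).
move: (vpick _) => u /memv_capP[uW]; rewrite mem_orthov1 => /eqP fuv u0.
have vu : v \notin <[u]>%VS by apply: contra vW => /vlineP[c ->]; rewrite memvZ.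
have [l l_uv] := exists_line u0 vu fuv.
have [q qu] := exists_point u0.
have /card_le1_eqP/(_ (inl p) (inl q)) := D_ovoid l.
rewrite !inE xD /= l_uv pv qu addvSl addvSr => /(_ isT).
rewrite (subsetP WD) ?mem_points_in ?qu -?memvE // => /(_ isT) [pq].
by case/negP: vu; rewrite -qu pq pv memv_line.
Qed.

Lemma points_in_neighbour_transitive :
  neighbour_transitive (adjacent f) (points_in f W).
Proof.
have [u uW u0] : exists2 u, u \in W & u != 0.
  by exists (vpick W); rewrite ?memv_pick // vpick0 -dimv_eq0 planeW.1.
have [w wW w0] : exists2 w, w \in W' & w != 0.
  by exists (vpick W'); rewrite ?memv_pick // vpick0 -dimv_eq0 planeW'.1.
have [p pu] := exists_point u0.
have pW : inl p \in points_in f W by rewrite mem_points_in pu -memvE.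
apply/andP; split; apply: code_aut_transitive.
- by apply/set0Pn; exists (inl p).
- by move=> s /mem_code_autP[_ sC] x; rewrite sC.
- move=> _ _ /imsetP[p1 + ->] /imsetP[p2 + ->]; rewrite !inE.
  have [u1 u10 pu1] := pointP p1; have [u2 u20 pu2] := pointP p2.
  rewrite pu1 pu2 -!memvE => u1W u2W.
  (* Only points of [W] have to be moved here, so the same [w] serves as source and target in
     [W']. *)
  have [g [g_iso gW gu _]] := plane_isometry u1W u2W u10 u20 wW wW w0 w0.
  exists (perm (img_vertex_inj g_iso)); first exact: img_vertex_code_aut.
  rewrite permE /=; congr inl; apply: val_inj.
  by rewrite val_img_point // pu1 pu2.
- have fuw : f u w = 0 by rewrite skewC (mem_orthovP wW) // oppr0.
  have [l l_uw] := exists_line u0 (notin_vline_orthov uW u0 wW w0) fuw.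
  apply/set0Pn; exists (inr l); rewrite !inE inr_points_in /=.
  by apply/exists_inP; exists (inl p); rewrite //= l_uw pu addvSl.
- by move=> s sC x; apply: code_aut_neighbours.
- move=> x1 x2 /neighbour_points_in[u1 [w1 [l1 [[u1W u10 w1W w10] {x1}-> l1E]]]].
  case/neighbour_points_in=> u2 [w2 [l2 [[u2W u20 w2W w20] -> l2E]]].
  have [g [g_iso gW gu gw]] := plane_isometry u1W u2W u10 u20 w1W w2W w10 w20.
  exists (perm (img_vertex_inj g_iso)); first exact: img_vertex_code_aut.
  rewrite permE /=; congr inr; apply: val_inj.
  by rewrite val_img_line // l1E l2E limgD gu gw.
Qed.

End HyperbolicLine.

End Quadrangle.

(** [is_psymplectic] asserts alternation in characteristic 2; otherwise skew symmetry gives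
    [f u u *+ 2 = 0] and 2 is invertible. *)
Lemma psymplectic_alternating (F : fieldType) (vT : vectType F)
    (f : {skew_symmetric vT}) :
  is_psymplectic f -> forall u, f u u = 0.
Proof.
case=> _ _ f2 u; have [/f2 //|char2] := boolP (2%N \in [pchar F]).
have: f u u *+ 2 == 0 by rewrite mulr2n {1}skewC addNr.
rewrite -mulr_natr mulf_eq0 => /orP[/eqP //|two0].
by case/negP: char2; rewrite inE /= two0.
Qed.

Theorem proposition5p2 (F : finFieldType) (f : {skew_symmetric 'rV[F]_4})
    (f_symplectic : is_psymplectic f) (W : {vspace 'rV[F]_4})
    (W_hyperbolic : is_hyperbolic_line f W) :
  neighbour_transitive (adjacent f) (points_in f W)
  /\ maximal_partial_ovoid f (points_in f W).
Proof.
have f_alt := psymplectic_alternating f_symplectic.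
have [f_ndg _ _] := f_symplectic.
split; first exact: points_in_neighbour_transitive.
exact: points_in_maximal.
Qed.
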